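(* Let $E$ be a CNF formula, $\mathfrak{F}$ a set of CNF formulas and $\mathcal{V}$ a family of sets of variables each of which respects $E$, and let $\Phi=\bigwedge_{F\in\mathfrak{F}}\bigwedge_{C\in F}C\land E$. Suppose the F–V graph $(\mathfrak{F},\mathcal{V})_E$ is an $(s,\delta,\xi,E)$-respectful boundary expander whose family $\mathcal{V}$ has overlap $d$, and suppose that for every $\mathfrak{F}'\subseteq\mathfrak{F}$ with $|\mathfrak{F}'|\le s$ the formula $\bigwedge_{F\in\mathfrak{F}'}F\land E$ is satisfiable. Then, over any field, every polynomial calculus refutation of $\Phi$ has degree strictly greater than $(\delta s-2\xi)/(2d)$.
   Context: A literal is a Boolean variable $x$ or its negation $\overline{x}$; clauses are disjunctions of literals, CNF formulas conjunctions (sets) of clauses; $\mathrm{vars}(\cdot)$ is the set of variables occurring in an object. A partial assignment $\rho$ has domain $\mathrm{dom}(\rho)$. A partial assignment $\rho$ respects a CNF formula $E$ if for every clause $C$ of $E$ either $\mathrm{vars}(C)\cap\mathrm{dom}(\rho)=\emptyset$ or $\rho$ satisfies $C$; a set $V$ of variables respects $E$ if some $\rho$ with $\mathrm{dom}(\rho)=V$ respects $E$. A CNF formula $F$ is $E$-respectfully satisfiable by $V$ if some $\rho$ with $\mathrm{dom}(\rho)=V$ satisfies $F$ and respects $E$. The F–V graph $(\mathfrak{F},\mathcal{V})_E$ is the bipartite graph with left vertices $F\in\mathfrak{F}$, right vertices $V\in\mathcal{V}$, and an edge $(F,V)$ iff $\mathrm{vars}(F)\cap V\ne\emptyset$; such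 a neighbour $V$ of $F$ is a respectful neighbour if $F$ is $E$-respectfully satisfiable by $V$. For $\mathfrak{F}'\subseteq\mathfrak{F}$ the respectful boundary $\partial^E(\mathfrak{F}')$ is the set of $V\in\mathcal{V}$ that are a respectful neighbour of some $F\in\mathfrak{F}'$ and not a neighbour of any $F'\in\mathfrak{F}'\setminus\{F\}$. The graph is an $(s,\delta,\xi,E)$-respectful boundary expander if $|\partial^E(\mathfrak{F}')|\ge\delta|\mathfrak{F}'|-\xi$ for all $\mathfrak{F}'\subseteq\mathfrak{F}$ with $|\mathfrak{F}'|\le s$. The overlap of $\mathcal{V}$ is the maximum, over variables $x$, of the number of sets $V\in\mathcal{V}$ with $x\in V$. Polynomial calculus: identify $0$ with true, $1$ with false; a clause $\bigvee_{x\in L^+}x\lor\bigvee_{y\in L^-}\overline{y}$ is translated into the polynomial $\prod_{x\in L^+}x\prod_{y\in L^-}(1-y)$. A (multilinear) polynomial calculus refutation over a field $\mathbb{F}$ is a sequence of multilinear polynomials in $\mathbb{F}[x,y,\dots]/\langle x^2-x,y^2-y,\dots\rangle$ ending in $1$, each line being the translation of a clause of the formula, a linear combination $\alpha Q+\beta R$ of earlier lines, or the multilinearized product $xQ$ of an earlier line $Q$ with a variable $x$; its degree is the maximum degree of a monomial occurring in it. (This minimal degree coincides with that of PC with explicit Boolean axioms and of PCR.)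
   Formalization: The formal theorem additionally assumes s ≥ 1; for s = 0 the claim fails (E empty, 𝔉 consisting of one formula whose only clause is empty, 𝒱 = {{x}}, ξ = 0: the bound is 0, but the one-line refutation ''1'' has degree 0). *)

(* Defs.v *)
From mathcomp Require Import all_boot all_order all_algebra.
From mathcomp Require Export mpoly.

Set Implicit Arguments.
Unset Strict Implicit.
Unset Printing Implicit Defensive.

Import GRing.Theory.
Local Open Scope ring_scope.

(* The literal (x, true) is the variable x, and (x, false) is its negation. *)
Notation literal n := ('I_n * bool)%type.
Notation clause n := {set literal n}.
Notation cnf n := {set clause n}.

(* rho x = None when x lies outside the domain of the partial assignment. *)
Notation passign n := {ffun 'I_n -> option bool}.

Section CNF.
Variable n : nat.
Implicit Types (C : clause n) (E F : cnf n) (rho : passign n) (V : {set 'I_n}).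

Definition clause_vars C : {set 'I_n} := [set l.1 | l in C].
Definition cnf_vars F : {set 'I_n} := \bigcup_(C in F) clause_vars C.

Definition pdom rho : {set 'I_n} := [set x | rho x != None].

Definition satisfies_clause rho C : bool :=
  [exists l in C, rho l.1 == Some l.2].

Definition satisfies rho F : bool := [forall C in F, satisfies_clause rho C].

Definition satisfiable F : bool := [exists rho, satisfies rho F].

Definition respects rho E : bool :=
  [forall C in E,
     (clause_vars C :&: pdom rho == set0) || satisfies_clause rho C].

Definition set_respects V E : bool :=
  [exists rho, (pdom rho == V) && respects rho E].

Definition respectfully_satisfiable E F V : bool :=
  [exists rho, [&& pdom rho == V, satisfies rho F & respects rho E]].

Definition cnf_conj (FF : {set cnf n}) E : cnf n := (\bigcup_(F in FF) F) :|: E.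

Definition neighbour F V : bool := cnf_vars F :&: V != set0.

Definition respectful_neighbour E F V : bool :=
  neighbour F V && respectfully_satisfiable E F V.

Definition respectful_boundary E (VV : {set {set 'I_n}}) (FF : {set cnf n}) :
    {set {set 'I_n}} :=
  [set V in VV | [exists F in FF,
     respectful_neighbour E F V && [forall G in FF :\ F, ~~ neighbour G V]]].

Definition respectful_boundary_expander (R : realFieldType)
    (FF : {set cnf n}) (VV : {set {set 'I_n}}) (s : nat) (delta xi : R) E :
    Prop :=
  forall FF' : {set cnf n}, FF' \subset FF -> (#|FF'| <= s)%N ->
    delta * #|FF'|%:R - xi <= #|respectful_boundary E VV FF'|%:R.

Definition overlap (VV : {set {set 'I_n}}) : nat :=
  \max_(x < n) #|[set V in VV | x \in V]|.

End CNF.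

Section PolynomialCalculus.
Variables (K : fieldType) (n : nat).
Implicit Types (P Q : {mpoly K[n]}) (Phi : cnf n) (pi : seq {mpoly K[n]}).

(* mlin P is the multilinear representative of P modulo the x ^+ 2 - x. *)
Definition mlin P : {mpoly K[n]} :=
  \sum_(m <- msupp P) P@_m *: 'X_[[multinom minn (m i) 1 | i < n]].

(* The value 0 stands for true and 1 for false. *)
Definition clause_poly (C : clause n) : {mpoly K[n]} :=
  mlin ((\prod_(x < n | (x, true) \in C) 'X_x) *
        (\prod_(y < n | (y, false) \in C) (1 - 'X_y))).

Variant pc_step Phi (prev : seq {mpoly K[n]}) : {mpoly K[n]} -> Prop :=
  | PCAxiom C of C \in Phi : pc_step Phi prev (clause_poly C)
  | PCLinear (a b : K) P Q of P \in prev & Q \in prev :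
      pc_step Phi prev (a *: P + b *: Q)
  | PCMul (x : 'I_n) P of P \in prev : pc_step Phi prev (mlin ('X_x * P)).

(* The last conjunct also forces pi to be nonempty, since 0 != 1 in K. *)
Definition pc_refutation Phi pi : Prop :=
  (forall i, (i < size pi)%N -> pc_step Phi (take i pi) (nth 0 pi i)) /\
  last 0 pi = 1.

Definition pc_degree pi : nat := \max_(P <- pi) \max_(m <- msupp P) mdeg m.

End PolynomialCalculus.

(* Main.v *)
Require Import Defs.
From HB Require Import structures.
From mathcomp Require Import all_boot all_order all_algebra.
From mathcomp Require Import mpoly zify lra.
From Stdlib Require Import Classical_Prop.

(* Following Alekhnovich-Razborov and Miksa-Nordstrom: were there a refutation
   of degree D <= (delta s - 2 xi) / (2 d), one could build a linear operator on
   multilinear polynomials of degree at most D that kills every line of it but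
   not 1.  The support of a monomial S is the union of all sets G of at most s
   formulas whose respectful boundary only contains sets V meeting S; expansion
   bounds such G by s / 2, so they are closed under union.  The operator maps S
   to its normal form modulo the polynomials vanishing on all total assignments
   that satisfy its support and E.  If V is in the boundary of G but avoids S,
   restricting by the respectful assignment of V removes a formula from G without
   changing the normal form of S; hence the normal form is the same modulo every
   set of at most s formulas containing the support.

   Because products are multilinearized, multiplying a line of degree D by x may
   keep the degree, which the usual argument does not cover.  The kernel of the
   operator does not depend on the monomial order, so for this step one chooses
   an order that depends on x. *)

Set Implicit Arguments.
Unset Strict Implicit.
Unset Printing Implicit Defensive.

Import Order.TTheory GRing.Theory Num.Theory.
Local Open Scope ring_scope.

(* The function S |-> c S stands for the multilinear polynomial with monomials
   prod_(x in S) x and coefficients c S; an assignment is the set a of variables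
   of value 1, that is, false. *)
Notation coefs K n := {ffun {set 'I_n} -> K^o}.

(** * Coefficient vectors *)

Section Coefficients.
Variables (K : fieldType) (n : nat).
Implicit Types (c f r : coefs K n) (S T a : {set 'I_n}).

Definition monomial S : coefs K n := [ffun T : {set 'I_n} => (T == S)%:R].

Lemma coefs_sum c : c = \sum_S c S *: monomial S.
Proof.
apply/ffunP=> T; rewrite sum_ffunE (bigD1 T) //= !ffunE eqxx.
rewrite big1 => [|S neST]; last by rewrite !ffunE eq_sym (negbTE neST) scaler0.
by rewrite addr0 /GRing.scale /= mulr1.
Qed.

Definition eval a c : K^o := \sum_(S : {set 'I_n} | S \subset a) c S.

Fact eval_is_linear a : linear (eval a).
Proof.
move=> k c f; rewrite /eval scaler_sumr -big_split /=.
by apply: eq_bigr => S _; rewrite !ffunE.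
Qed.

HB.instance Definition _ a :=
  GRing.isLinear.Build K (coefs K n) K^o *:%R (eval a) (eval_is_linear a).

Lemma eval_monomial a S : eval a (monomial S) = (S \subset a)%:R.
Proof.
rewrite /eval big_mkcond (bigD1 S) //= ffunE eqxx big1 ?addr0; first by case: ifP.
by move=> T neTS; rewrite ffunE (negbTE neTS) if_same.
Qed.

(** Induction on the size of [S]: the value at the point [S] is [c S] plus coefficients of proper
    subsets. Identities can thus be checked pointwise. *)
Lemma eval_inj c f : (forall a, eval a c = eval a f) -> c = f.
Proof.
move=> eq_cf; apply/ffunP=> S; have [k] := ubnP #|S|; elim: k S => // k IHk S ltSk.
have := eq_cf S; rewrite /eval (bigD1 S) //= [RHS](bigD1 S) //=.
rewrite (eq_bigr f) => [/addIr //|T /andP[sTS neTS]].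
apply: IHk; rewrite ltnS in ltSk; apply: leq_trans ltSk; apply: proper_card.
by rewrite properEneq neTS.
Qed.

(** As x squared is x, the monomials [S] and [S :\ x] both become [S]. *)
Definition varmul (x : 'I_n) c : coefs K n :=
  [ffun S : {set 'I_n} => if x \in S then c S + c (S :\ x) else 0].

Lemma eval_varmul x a c : eval a (varmul x c) = (x \in a)%:R * eval a c.
Proof.
have [xa | xNa] := boolP (x \in a); last first.
  rewrite mul0r; apply: big1 => S /subsetP sSa; rewrite ffunE.
  by case: ifP => // /sSa; rewrite (negbTE xNa).
rewrite mul1r /eval [RHS](bigID (fun S => x \in S)) /=.
rewrite [LHS](bigID (fun S => x \in S)) /= [X in _ + X]big1 ?addr0; last first.
  by move=> S /andP[_ /negbTE xNS]; rewrite ffunE xNS.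
rewrite (eq_bigr (fun S => c S + c (S :\ x))); last first.
  by move=> S /andP[_ xS]; rewrite ffunE xS.
rewrite big_split /=; congr (_ + _).
rewrite (reindex_onto (fun S => x |: S) (fun S => S :\ x)) /=; last first.
  by move=> S /andP[_ xS]; rewrite setD1K.
apply: eq_big => S.
  rewrite subUset sub1set xa setU11 andbT /=.
  have [xS | xNS] := boolP (x \in S); last by rewrite setU1K ?eqxx.
  rewrite andbF; apply/andP=> -[_ /eqP eqS].
  by move: xS; rewrite -eqS setD11.
by move=> /andP[_ /eqP ->].
Qed.

Lemma varmul_linear x : linear (varmul x).
Proof.
move=> k c f; apply: eval_inj => a.
rewrite eval_varmul !linearP /= !eval_varmul mulrDr; congr (_ + _).
exact: mulrCA.
Qed.

HB.instance Definition _ x :=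
  GRing.isLinear.Build K (coefs K n) (coefs K n) *:%R (varmul x) (varmul_linear x).

(* rho x = Some true sets x to 0, hence kills the monomials containing x. *)
Definition survives (rho : passign n) S := [forall x in S, rho x != Some true].

(** Variables set to false take the value 1 and drop out of the surviving monomials; monomials that
    become equal are collected. *)
Definition restrict (rho : passign n) c : coefs K n :=
  [ffun T : {set 'I_n} =>
     \sum_(S : {set 'I_n} | survives rho S && (S :\: pdom rho == T)) c S].

Definition override (rho : passign n) a : {set 'I_n} :=
  [set x | if rho x is Some b then ~~ b else x \in a].

Lemma sub_override rho a S :
  (S \subset override rho a) = survives rho S && (S :\: pdom rho \subset a).
Proof.
apply/subsetP/andP=> [sSo | [/forall_inP surv /subsetP sSa] x xS].
  split; first by apply/forall_inP=> x /sSo; rewrite inE; case: (rho x) => [[]|].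
  apply/subsetP=> x; rewrite !inE negbK => /andP[/eqP rho_x /sSo].
  by rewrite inE rho_x.
have := surv x xS; have := sSa x; rewrite !inE xS.
by case: (rho x) => [[]|] //= ->.
Qed.

Lemma eval_restrict rho a c : eval a (restrict rho c) = eval (override rho a) c.
Proof.
rewrite /eval (eq_bigl _ _ (sub_override rho a)).
rewrite [RHS](partition_big (fun S => S :\: pdom rho) (fun T => T \subset a)) /=.
  apply: eq_bigr => T sTa; rewrite ffunE; apply: eq_bigl => S.
  by case: eqP => [-> | _]; rewrite ?andbF // !andbT sTa andbT.
by move=> S /andP[].
Qed.

Lemma restrict_linear rho : linear (restrict rho).
Proof.
move=> k c f; apply: eval_inj => a.
by rewrite eval_restrict !linearP /= !eval_restrict.
Qed.

HB.instance Definition _ rho :=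
  GRing.isLinear.Build K (coefs K n) (coefs K n) *:%R (restrict rho)
    (restrict_linear rho).

Lemma restrict_disjoint rho c :
  (forall S, c S != 0 -> [disjoint S & pdom rho]) -> restrict rho c = c.
Proof.
move=> disj; apply: eval_inj => a; rewrite eval_restrict /eval.
rewrite big_mkcond [RHS]big_mkcond; apply: eq_bigr => S _.
have [-> | /disj dS] := eqVneq (c S) 0; first by rewrite !if_same.
rewrite sub_override (setDidPl dS) (_ : survives rho S) //.
apply/forall_inP => x xS; apply: contraL dS => /eqP rho_x.
by apply/pred0Pn; exists x; rewrite /= xS inE rho_x.
Qed.

End Coefficients.

(** * Normal forms modulo a subspace *)

Section Reduction.
Variables (K : fieldType) (n : nat) (o : {set 'I_n} -> nat).
Implicit Types (c f r : coefs K n) (S T a : {set 'I_n}) (W : coefs K n -> Prop).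

Definition subspace W := W 0 /\ forall k f r, W f -> W r -> W (k *: f + r).

Lemma subspaceB W f r : subspace W -> W f -> W r -> W (f - r).
Proof.
by move=> [_ Wlin] Wf Wr; rewrite addrC -scaleN1r; apply: Wlin.
Qed.

Lemma subspace_sum W (I : finType) (P : pred I) (k : I -> K) (F : I -> coefs K n) :
  subspace W -> (forall i, P i -> W (F i)) -> W (\sum_(i | P i) k i *: F i).
Proof.
move=> [W0 Wlin] WF; elim/big_rec: _ => // i r Pi Wr.
exact: Wlin (WF i Pi) Wr.
Qed.

(** [S] is the leading monomial, for the order [o], of an element of [W]. *)
Definition reducible W S :=
  exists f, [/\ W f, f S != 0 & forall T, f T != 0 -> (o T <= o S)%N].

Definition irreducible W r := forall S, r S != 0 -> ~ reducible W S.

Definition normal_form W S r :=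
  [/\ W (monomial K S - r), irreducible W r
    & forall T, r T != 0 -> (o T <= o S)%N].

Hypothesis o_inj : injective o.

Lemma irreducible_eq0 W r : W r -> irreducible W r -> r = 0.
Proof.
move=> Wr irr; apply/ffunP=> S0; rewrite [RHS]ffunE; apply/eqP/negPn/negP=> nzr.
pose S := [arg max_(S > S0 | r S != 0) o S].
have [nzS maxS]: r S != 0 /\ forall T, r T != 0 -> (o T <= o S)%N.
  by rewrite /S; case: arg_maxnP.
by apply: (irr S nzS); exists r.
Qed.

Lemma irreducible_lin W k f r :
  irreducible W f -> irreducible W r -> irreducible W (k *: f + r).
Proof.
move=> irrf irrr S; rewrite !ffunE => nz.
have [r0 | /irrr //] := eqVneq (r S) 0.
by apply: irrf; apply: contra nz => /eqP ->; rewrite r0 scaler0 addr0.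
Qed.

Lemma irreducible_sum W (I : finType) (P : pred I) (k : I -> K) (F : I -> coefs K n) :
  (forall i, P i -> irreducible W (F i)) ->
  irreducible W (\sum_(i | P i) k i *: F i).
Proof.
move=> irrF; elim/big_rec: _ => [S|i r Pi irr_r]; first by rewrite ffunE eqxx.
by apply: irreducible_lin => //; apply: irrF.
Qed.

Lemma irreducible_uniq W f r : subspace W -> irreducible W f -> irreducible W r ->
  W (f - r) -> f = r.
Proof.
move=> sW irrf irrr Wfr; apply/eqP; rewrite -subr_eq0; apply/eqP.
apply: irreducible_eq0 Wfr _; rewrite addrC -scaleN1r.
exact: irreducible_lin.
Qed.

Lemma irreducibleS W1 W2 r : (forall f, W1 f -> W2 f) ->
  irreducible W2 r -> irreducible W1 r.
Proof.
move=> sW irr S /irr nred [f [Wf nz le]]; apply: nred.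
by exists f; split=> //; apply: sW.
Qed.

(** Induction on [o S]: if [f] in [W] has leading monomial [S], then modulo [W] it rewrites [S]
    through smaller monomials, which already have normal forms. *)
Lemma normal_form_exists W S : subspace W -> exists r, normal_form W S r.
Proof.
move=> sW; have [k] := ubnP (o S); elim: k S => // k IHk S; rewrite ltnS => leSk.
have [[f [Wf nzS leS]] | irrS] := classic (reducible W S); last first.
  exists (monomial K S); split; first by rewrite subrr; case: sW.
    by move=> T; rewrite ffunE; have [-> | _] := eqVneq T S; rewrite ?eqxx.
  by move=> T; rewrite ffunE; have [-> | _] := eqVneq T S; rewrite ?eqxx.
have ltS T : f T != 0 -> T != S -> (o T < o S)%N.
  move=> /leS leTS neTS; rewrite ltn_neqAle leTS andbT.
  by apply: contra neTS => /eqP/o_inj->.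
have /fin_all_exists[R nfR] T : exists r, f T != 0 -> T != S -> normal_form W T r.
  have [fT0 | nzT] := eqVneq (f T) 0; first by exists 0.
  have [eqTS | neTS] := eqVneq T S; first by exists 0.
  have [r nfr] := IHk T (leq_trans (ltS T nzT neTS) leSk).
  by exists r.
(* The coefficients obtained by solving [f = 0] for the monomial [S]. *)
pose k' T := - ((f S)^-1 * f T).
exists (\sum_(T | (f T != 0) && (T != S)) k' T *: R T); split.
- rewrite (_ : _ - _ = (f S)^-1 *: f +
    \sum_(T | (f T != 0) && (T != S)) k' T *: (monomial K T - R T)); last first.
    under [X in _ = _ + X]eq_bigr do rewrite scalerBr.
    rewrite sumrB addrA; congr (_ - _).
    have -> : (f S)^-1 *: f =
        monomial K S + \sum_(T | T != S) ((f S)^-1 * f T) *: monomial K T.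
      rewrite [X in _ *: X]coefs_sum scaler_sumr (bigD1 S) //= scalerA mulVf // scale1r.
      by under eq_bigr do rewrite scalerA.
    rewrite -addrA -[LHS]addr0; congr (_ + _).
    rewrite big_mkcondl -big_split /= big1 // => T _.
    have [-> | _] := eqVneq (f T) 0; first by rewrite mulr0 scale0r addr0.
    by rewrite /k' scaleNr subrr.
  case: (sW) => _; apply; first exact: Wf.
  by apply: subspace_sum => // T /andP[nz ne]; case: (nfR T nz ne).
- by apply: irreducible_sum => T /andP[nz ne]; case: (nfR T nz ne).
- move=> T; rewrite sum_ffunE => nzT; apply/negP => ltST; case/eqP: nzT.
  apply: big1 => U /andP[nz ne]; rewrite ffunE.
  have [_ _ leR] := nfR U nz ne.
  have [-> | /leR leTU] := eqVneq (R U T) 0; first exact: scaler0.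
  by case: ltST; apply: leq_trans leTU (leS U nz).
Qed.

Hypothesis o_card : forall S T, (o T <= o S)%N -> (#|T| <= #|S|)%N.

(* The largest monomial of r meeting the domain of rho would be the leading
   monomial of r - restrict rho r. *)
Lemma irreducible_restrict W rho r : irreducible W r ->
  W (r - restrict rho r) -> forall S, r S != 0 -> [disjoint S & pdom rho].
Proof.
move=> irr Wr S0 nzS0; apply/negPn/negP=> hitS0.
pose hit S := (r S != 0) && ~~ [disjoint S & pdom rho].
pose S := [arg max_(S > S0 | hit S) o S].
have [/andP[nzS hS] maxS]: hit S /\ forall T, hit T -> (o T <= o S)%N.
  by rewrite /S; case: arg_maxnP => //; apply/andP.
apply: (irr S nzS); exists (r - restrict rho r); split => //.
  rewrite !ffunE big1 ?subr0 // => T /andP[_ /eqP eqT].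
  by case/negP: hS; rewrite -eqT disjoints_subset subsetDr.
move=> T; apply: contraR; rewrite -ltnNge => ltST; rewrite !ffunE.
have zero (U : {set 'I_n}) : ~~ [disjoint U & pdom rho] -> (o S < o U)%N -> r U = 0.
  move=> hU; rewrite ltnNge => nle; apply/eqP/negPn/negP=> nzU; case/negP: nle.
  by apply: maxS; rewrite /hit nzU.
have [dT | hT] := boolP [disjoint T & pdom rho]; last first.
  rewrite (zero T) // sub0r oppr_eq0 big1 // => U /andP[_ /eqP eqT].
  by case/negP: hT; rewrite -eqT disjoints_subset subsetDr.
(* [T] is its own image, which cancels [r T]; any other preimage is a proper superset of [T] meeting
   the domain, hence larger than [S], so its coefficient is 0. *)
rewrite (bigD1 T) /=; last first.
  rewrite (setDidPl dT) eqxx andbT; apply/forall_inP => x xT.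
  apply: contraL dT => /eqP rho_x.
  by apply/pred0Pn; exists x; rewrite /= xT inE rho_x.
rewrite opprD addNKr oppr_eq0 big1 // => U /andP[/andP[_ /eqP eqT] neU].
have hU : ~~ [disjoint U & pdom rho].
  by apply: contra neU => dU; rewrite -eqT (setDidPl dU).
apply: zero => //; apply: (ltn_trans ltST); rewrite ltnNge; apply/negP=> /o_card.
apply/negP; rewrite -ltnNge; apply: proper_card.
by rewrite properEneq eq_sym neU -eqT subsetDl.
Qed.

End Reduction.

(** * Multilinear polynomials and refutations *)

Section MultilinearPolynomials.
Variables (K : fieldType) (n : nat).
Implicit Types (P Q : {mpoly K[n]}) (C : clause n) (c : coefs K n) (S a : {set 'I_n}).

Definition mlcoefs P : coefs K n := [ffun S : {set 'I_n} => P@_(mesym1 S)].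

Fact mlcoefs_is_linear : linear mlcoefs.
Proof. by move=> k P Q; apply/ffunP=> S; rewrite !ffunE linearP. Qed.

HB.instance Definition _ :=
  GRing.isLinear.Build K {mpoly K[n]} (coefs K n) *:%R mlcoefs mlcoefs_is_linear.

Lemma mlcoefs1 : mlcoefs 1 = monomial K set0.
Proof.
apply/ffunP=> S; rewrite !ffunE mcoeff1 -mesym1_set0.
by rewrite (inj_eq (@inj_mesym1 n)).
Qed.

Definition multilinear P := forall m, P@_m != 0 -> exists S, m = mesym1 S.

Lemma multilinear_lin (k l : K) P Q :
  multilinear P -> multilinear Q -> multilinear (k *: P + l *: Q).
Proof.
move=> mP mQ m; rewrite mcoeffD !mcoeffZ.
have [-> | /mP //] := eqVneq P@_m 0.
have [-> | /mQ //] := eqVneq Q@_m 0.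
by rewrite !mulr0 addr0 eqxx.
Qed.

Lemma minn_mesym1 (m : 'X_{1..n}) :
  [multinom minn (m i) 1 | i < n] = mesym1 [set i | m i != 0%N].
Proof. by apply/mnmP=> i; rewrite !mnmE inE; case: (m i) => [|[]]. Qed.

Lemma multilinear_mlin P : multilinear (mlin P).
Proof.
move=> m; rewrite /mlin raddf_sum /= => nz.
have [/hasP[k _ /eqP <-] | /hasPn noS] :=
    boolP (has (fun k : 'X_{1..n} => [multinom minn (k i) 1 | i < n] == m) (msupp P)).
  by exists [set i | k i != 0%N]; rewrite minn_mesym1.
case/eqP: nz; rewrite big_seq big1 // => k /noS /negbTE nek.
by rewrite mcoeffZ mcoeffX nek mulr0.
Qed.

Definition indic a (x : 'I_n) : K := (x \in a)%:R.

Lemma meval_mesym1 a S : 'X_[mesym1 S].@[indic a] = (S \subset a)%:R.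
Proof.
rewrite mevalX; have [/subsetP sSa | /subsetPn[x xS xNa]] := boolP (S \subset a).
  apply: big1 => x _; rewrite /indic mnmE; case: (boolP (x \in S)) => [/sSa -> | _].
    by rewrite expr1.
  by rewrite expr0.
by rewrite (bigD1 x) //= /indic mnmE xS (negbTE xNa) mul0r.
Qed.

Lemma eval_mlcoefs P a : multilinear P -> eval a (mlcoefs P) = P.@[indic a].
Proof.
move=> mP; have -> : P = \sum_S P@_(mesym1 S) *: 'X_[mesym1 S].
  apply/mpolyP=> m; rewrite raddf_sum /=.
  under eq_bigr do rewrite mcoeffZ mcoeffX.
  have [Pm0 | /mP[S ->]] := eqVneq P@_m 0.
    rewrite Pm0 big1 // => S _.
    by have [-> | _] := eqVneq (mesym1 S) m; rewrite ?Pm0 ?mul0r ?mulr0.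
  rewrite (bigD1 S) //= eqxx mulr1 big1 ?addr0 // => T neTS.
  by rewrite (inj_eq (@inj_mesym1 n)) (negbTE neTS) mulr0.
rewrite !raddf_sum /=; apply: eq_bigr => S _; rewrite linearZ /= mevalZ meval_mesym1.
rewrite (_ : mlcoefs 'X_[mesym1 S] = monomial K S) ?linearZ /= ?eval_monomial //.
by apply/ffunP=> T; rewrite !ffunE mcoeffX (inj_eq (@inj_mesym1 n)) eq_sym.
Qed.

Lemma meval_mlin P a : (mlin P).@[indic a] = P.@[indic a].
Proof.
rewrite [in RHS](mpolyE P) /mlin !raddf_sum /=; apply: eq_bigr => m _.
rewrite !mevalZ !mevalX; congr (_ * _); apply: eq_bigr => x _.
rewrite mnmE /indic; case: (x \in a); first by rewrite !expr1n.
by case: (m x) => [|[|k]] //=; rewrite !expr0n.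
Qed.

Lemma mlcoefs_varmul x P : multilinear P ->
  mlcoefs (mlin ('X_x * P)) = varmul x (mlcoefs P).
Proof.
move=> mP; apply: eval_inj => a; rewrite eval_mlcoefs; last exact: multilinear_mlin.
by rewrite meval_mlin mevalM mevalXU eval_varmul eval_mlcoefs.
Qed.

Definition falsifies a C := [forall l in C, l.2 == (l.1 \in a)].

Lemma eval_clause_poly C a : eval a (mlcoefs (clause_poly K C)) = (falsifies a C)%:R.
Proof.
rewrite eval_mlcoefs; last exact: multilinear_mlin.
rewrite /clause_poly meval_mlin mevalM !rmorph_prod /=.
have [/forall_inP fals | ] := boolP (falsifies a C).
  rewrite !big1 ?mulr1 // => x xC; have /= := fals _ xC.
    by rewrite mevalB meval1 mevalXU /indic; case: (x \in a); rewrite ?subr0.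
  by rewrite mevalXU /indic => /eqP <-.
rewrite negb_forall_in => /exists_inP[[x b] /= xC].
case: b xC => xC /negbTE; [rewrite eq_sym eqb_id|]; move=> xa.
  by rewrite (bigD1 x) //= mevalXU /indic xa !mul0r.
rewrite [X in _ * X](bigD1 x) //= mevalB meval1 mevalXU /indic.
by move: xa; case: (x \in a) => // _; rewrite subrr mul0r mulr0.
Qed.

Definition tautology C := [exists x, ((x, true) \in C) && ((x, false) \in C)].

(** The polynomial is built literal by literal, so that its monomials and its top coefficient, 1 or
    -1, can be followed. A tautology contributes a factor x (1 - x), which is 0. *)
Lemma clause_coefs C : exists c, [/\ forall a, eval a c = (falsifies a C)%:R,
  forall S, c S != 0 -> S \subset clause_vars C
  & ~~ tautology C -> c (clause_vars C) != 0].
Proof.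
have [k] := ubnP #|C|; elim: k C => // k IHk C ltCk.
have [-> | [l lC]] := set_0Vmem C.
  have v0 : clause_vars (set0 : clause n) = set0 by rewrite /clause_vars imset0.
  exists (monomial K set0); split=> [a | S |_].
  - rewrite eval_monomial sub0set; congr (nat_of_bool _)%:R; apply/esym/forall_inP.
    by move=> l; rewrite inE.
  - by rewrite v0 ffunE; have [-> | _] := eqVneq S set0; rewrite ?eqxx.
  - by rewrite v0 ffunE eqxx oner_eq0.
have [c [evc supc topc]] : exists c, [/\ forall a, eval a c = (falsifies a (C :\ l))%:R,
  forall S, c S != 0 -> S \subset clause_vars (C :\ l)
  & ~~ tautology (C :\ l) -> c (clause_vars (C :\ l)) != 0].
  by apply: IHk; rewrite (cardsD1 l) lC in ltCk.
have varsC : clause_vars C = l.1 |: clause_vars (C :\ l).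
  by rewrite -[in LHS](setD1K lC) /clause_vars imsetU1.
have falsC a : falsifies a C = (l.2 == (l.1 \in a)) && falsifies a (C :\ l).
  apply/forall_inP/andP=> [fals | [lt /forall_inP fals] l' l'C].
    by split; [apply: fals | apply/forall_inP=> l' /setD1P[_ /fals]].
  by have [-> | ne] := eqVneq l' l; last by apply: fals; rewrite !inE ne.
have supx S : varmul l.1 c S != 0 -> S \subset clause_vars C.
  rewrite ffunE; case: ifP => // xS; last by rewrite eqxx.
  rewrite varsC; have [-> | /supc sS _] := eqVneq (c S) 0; last first.
    exact: subset_trans sS (subsetUr _ _).
  by rewrite add0r => /supc; rewrite subDset.
exists (if l.2 then varmul l.1 c else c - varmul l.1 c); split.
- move=> a; rewrite falsC; case: l.2; rewrite ?raddfB /= eval_varmul evc.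
    by case: (l.1 \in a); rewrite ?mul1r ?mul0r.
  by case: (l.1 \in a); rewrite ?mul1r ?mul0r ?subrr ?subr0.
- move=> S; case: l.2 => [/supx //|]; rewrite !ffunE.
  have [c0 | /supc sS _] := eqVneq (c S) 0.
    by rewrite c0 sub0r oppr_eq0 => nz; apply: supx; rewrite ffunE c0.
  by apply: subset_trans sS _; rewrite varsC subsetUr.
move=> ntC.
have ntC' : ~~ tautology (C :\ l).
  apply: contra ntC => /existsP[x /andP[/setD1P[_ xt] /setD1P[_ xf]]].
  by apply/existsP; exists x; rewrite xt.
have lNv : l.1 \notin clause_vars (C :\ l).
  apply: contra ntC => /imsetP[l' /setD1P[ne l'C] eql].
  have ne2 : l'.2 != l.2.
    apply: contra ne => /eqP e2; apply/eqP.
    by rewrite (surjective_pairing l') -eql e2 -surjective_pairing.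
  have xC : (l.1, l.2) \in C by rewrite -surjective_pairing.
  have x'C : (l.1, l'.2) \in C by rewrite eql -surjective_pairing.
  by apply/existsP; exists l.1; move: ne2 xC x'C; case: l.2; case: l'.2 => // _ -> ->.
have c0 : c (clause_vars C) = 0.
  apply/eqP/negPn/negP=> /supc; rewrite varsC subUset sub1set.
  by rewrite (negbTE lNv).
have -> : (if l.2 then varmul l.1 c else c - varmul l.1 c) (clause_vars C)
   = (if l.2 then 1 else -1) * c (clause_vars (C :\ l)).
  have e : varmul l.1 c (clause_vars C) = c (clause_vars (C :\ l)).
    by rewrite ffunE c0 varsC setU11 setU1K // add0r.
  case: l.2; first by rewrite mul1r.
  by rewrite [LHS]ffunE [X in _ + X]ffunE e c0 add0r mulN1r.
by rewrite mulf_neq0 ?topc //; case: l.2; rewrite ?oppr_eq0 oner_eq0.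
Qed.

Lemma clause_poly_supp C S :
  mlcoefs (clause_poly K C) S != 0 -> S \subset clause_vars C.
Proof.
have [c [evc supc _]] := clause_coefs C.
have -> : mlcoefs (clause_poly K C) = c; last exact: supc.
by apply: eval_inj => a; rewrite evc eval_clause_poly.
Qed.

(** Lets the degree of a nonzero axiom bound the number of variables of its clause. *)
Lemma clause_poly_top C :
  mlcoefs (clause_poly K C) = 0 \/ mlcoefs (clause_poly K C) (clause_vars C) != 0.
Proof.
have [c [evc _ topc]] := clause_coefs C.
have -> : mlcoefs (clause_poly K C) = c.
  by apply: eval_inj => a; rewrite evc eval_clause_poly.
have [/existsP[x /andP[xt xf]] | /topc] := boolP (tautology C); last by right.
left; apply: eval_inj => a; rewrite evc linear0.
suff -> : falsifies a C = false by [].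
apply/forall_inP=> fals; have := fals _ xt; rewrite -(eqP (fals _ xf)).
by [].
Qed.

Lemma mlcoefs_degree (pi : seq {mpoly K[n]}) P S :
  P \in pi -> mlcoefs P S != 0 -> (#|S| <= pc_degree pi)%N.
Proof.
rewrite ffunE -mcoeff_msupp => Ppi Sin; rewrite -mdeg_mesym1.
apply: leq_trans (leq_bigmax_seq P Ppi isT) .
exact: (leq_bigmax_seq (mesym1 S) Sin isT).
Qed.

(** Carries multilinearity along and gives the product step both lines as members of [pi], so that
    both obey the degree bound. *)
Lemma pc_ind Phi (pi : seq {mpoly K[n]}) (I : {mpoly K[n]} -> Prop) :
  (forall i, (i < size pi)%N -> pc_step Phi (take i pi) (nth 0 pi i)) ->
  (forall C, C \in Phi -> clause_poly K C \in pi -> I (clause_poly K C)) ->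
  (forall (k l : K) P Q, I P -> I Q -> I (k *: P + l *: Q)) ->
  (forall x P, P \in pi -> mlin ('X_x * P) \in pi -> multilinear P -> I P ->
     I (mlin ('X_x * P))) ->
  forall P, P \in pi -> I P.
Proof.
move=> steps Iax Ilin Imul.
suff IH i : (i < size pi)%N -> multilinear (nth 0 pi i) /\ I (nth 0 pi i).
  by move=> P /(nthP 0)[i /IH[_ ?] <-].
elim/ltn_ind: i => i IH lti.
have prev P : P \in take i pi -> [/\ P \in pi, multilinear P & I P].
  move=> Pin; split; first exact: mem_take Pin.
    have /(nthP 0)[j] := Pin; rewrite size_take lti => ltji.
    by rewrite nth_take // => <-; case: (IH j ltji (ltn_trans ltji lti)).
  have /(nthP 0)[j] := Pin; rewrite size_take lti => ltji.
  by rewrite nth_take // => <-; case: (IH j ltji (ltn_trans ltji lti)).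
have := mem_nth 0 lti; case: (steps i lti) => [C CPhi | a b P Q | x P].
- by split; [apply: multilinear_mlin | apply: Iax].
- move=> /prev[_ mP IP] /prev[_ mQ IQ] _.
  by split; [apply: multilinear_lin | apply: Ilin].
- move=> /prev[Ppi mP IP] xPpi.
  by split; [apply: multilinear_mlin | apply: Imul].
Qed.

End MultilinearPolynomials.

(** * Supports *)

Lemma add_halves k l m : (2 * k <= m)%N -> (2 * l <= m)%N -> (k + l <= m)%N.
Proof. lia. Qed.

Section Supports.
Variables (n : nat) (E : cnf n) (FF : {set cnf n}) (VV : {set {set 'I_n}}).
Variables (s D : nat).
Implicit Types (F : cnf n) (G H : {set cnf n}) (S T Y V : {set 'I_n}).

Definition touched S : {set {set 'I_n}} := [set V in VV | ~~ [disjoint S & V]].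

Lemma touchedS S T : S \subset T -> touched S \subset touched T.
Proof.
move=> sST; apply/subsetP=> V; rewrite !inE => /andP[-> /=].
by apply: contra; apply: disjointWl.
Qed.

Lemma card_touched S : (#|touched S| <= overlap VV * #|S|)%N.
Proof.
apply: (@leq_trans #|\bigcup_(x in S) [set V in VV | x \in V]|).
  apply/subset_leq_card/subsetP=> V; rewrite inE => /andP[VVV].
  rewrite -setI_eq0 => /set0Pn[x /setIP[xS xV]].
  by apply/bigcupP; exists x; rewrite // inE VVV.
rewrite mulnC -sum_nat_const.
elim/big_rec2: _ => [|x m A _ leA]; first by rewrite cards0.
rewrite cardsU (leq_trans (leq_subr _ _)) // leq_add //.
exact: (leq_bigmax x).
Qed.

Lemma respectful_boundaryP G V :
  reflect (V \in VV /\ exists F, [/\ F \in G, respectful_neighbour E F V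
             & forall F', F' \in G -> F' != F -> ~~ neighbour F' V])
    (V \in respectful_boundary E VV G).
Proof.
rewrite inE; apply: (iffP andP) => -[VVV].
  case/exists_inP=> F FG /andP[rn /forall_inP nn]; split=> //; exists F.
  by split=> // F' F'G ne; apply: nn; rewrite !inE ne.
case=> F [FG rn nn]; split=> //; apply/exists_inP; exists F => //.
by rewrite rn; apply/forall_inP=> F' /setD1P[ne F'G]; apply: nn.
Qed.

Definition contained S G :=
  [&& G \subset FF, (#|G| <= s)%N & respectful_boundary E VV G \subset touched S].

Definition support S : {set cnf n} := \bigcup_(G : {set cnf n} | contained S G) G.

Lemma support_max S G : contained S G -> G \subset support S.
Proof. by move=> cG; apply: (bigcup_sup G). Qed.

Lemma supportS S T : S \subset T -> support S \subset support T.
Proof.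
move=> sST; apply/bigcupsP=> G /and3P[sGF leGs bG]; apply: support_max.
by rewrite /contained sGF leGs (subset_trans bG) ?touchedS.
Qed.

(** The form in which expansion enters: a boundary touched by at most [D] variables improves the
    size bound from [s] to half of [s]. *)
Hypothesis contained_half : forall S G,
  (#|S| <= D)%N -> contained S G -> (2 * #|G| <= s)%N.

(** Two halves stay within [s], and a boundary set of the union is one for the part that contains
    its respectful neighbour, as fewer formulas compete there. *)
Lemma containedU S G H : (#|S| <= D)%N ->
  contained S G -> contained S H -> contained S (G :|: H).
Proof.
move=> leSD cG cH; have := contained_half leSD cG; have := contained_half leSD cH.
case/and3P: cG => sG _ bG; case/and3P: cH => sH _ bH lH lG.
apply/and3P; split; first by rewrite subUset sG.
  by rewrite cardsU; lia.
apply/subsetP=> V /respectful_boundaryP[VVV [F [FGH rn nn]]].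
case/setUP: FGH => FG; [apply: (subsetP bG) | apply: (subsetP bH)];
  apply/respectful_boundaryP; split=> //; exists F; split=> // F' F'G;
  by apply: nn; rewrite inE F'G ?orbT.
Qed.

Lemma support_contained S : (#|S| <= D)%N -> contained S (support S).
Proof.
move=> leSD; rewrite /support; elim/big_ind: _ => [|G H|//]; last exact: containedU.
apply/and3P; split; rewrite ?sub0set ?cards0 //.
by apply/subsetP=> V /respectful_boundaryP[_ [F []]]; rewrite inE.
Qed.

Lemma support_sub S : support S \subset FF.
Proof. by apply/bigcupsP=> G /and3P[]. Qed.

Lemma card_support S : (#|S| <= D)%N -> (2 * #|support S| <= s)%N.
Proof. by move=> leSD; apply: (contained_half leSD); apply: support_contained. Qed.

(** If the only neighbour [F] of [V] in [G] lay in [support S], then [V] would be in the boundary of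
    [support S], all of whose sets are touched by [S]. *)
Lemma escaping_boundary S G V : (#|S| <= D)%N -> support S \subset G ->
  V \in respectful_boundary E VV G -> [disjoint S & V] ->
  exists F rho, [/\ F \in G :\: support S, pdom rho = V, satisfies rho F, respects rho E
     & forall F', F' \in G -> F' != F -> ~~ neighbour F' V].
Proof.
move=> leSD sSG /respectful_boundaryP[VVV [F [FG rn nn]]] dSV.
have /andP[_ /existsP[rho /and3P[/eqP dom sat resp]]] := rn.
exists F, rho; split=> //; rewrite inE FG andbT; apply/negP=> FS.
have /and3P[_ _ /subsetP bS] := support_contained leSD.
have : V \in touched S.
  apply: bS; apply/respectful_boundaryP; split=> //; exists F; split=> //.
  by move=> F' F'S; apply: nn; apply: (subsetP sSG).
by rewrite inE dSV andbF.
Qed.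

(** * Polynomials vanishing on the models of a set of formulas *)

Variable K : fieldType.
Implicit Types (c f r : coefs K n) (a : {set 'I_n}) (C : clause n).

Definition models G a := forall C, C \in cnf_conj G E -> ~~ falsifies a C.

Definition vanishing G c := forall a, models G a -> eval a c = 0.

Lemma vanishing_subspace G : subspace (vanishing G).
Proof.
split=> [a _ | k f r Wf Wr a ma]; first exact: linear0.
by rewrite linearP /= Wf // Wr // scaler0 addr0.
Qed.

Lemma vanishingS G H c : G \subset H -> vanishing G c -> vanishing H c.
Proof.
move=> /subsetP sGH Wc a ma; apply: Wc => C CG; apply: ma.
case/setUP: CG => [/bigcupP[F FG CF] | CE]; apply/setUP; [left | by right].
by apply/bigcupP; exists F => //; apply: sGH.
Qed.

Lemma satisfies_clause_override rho a C :
  satisfies_clause rho C -> ~~ falsifies (override rho a) C.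
Proof.
case/exists_inP=> l lC /eqP rho_l; rewrite negb_forall_in; apply/exists_inP.
by exists l => //; rewrite inE rho_l; case: l.2.
Qed.

Lemma untouched_override rho a C : clause_vars C :&: pdom rho = set0 ->
  ~~ falsifies a C -> ~~ falsifies (override rho a) C.
Proof.
move=> dC; apply: contra => /forall_inP fals; apply/forall_inP=> l lC.
have := fals l lC; rewrite [_ \in override _ _]inE.
have : l.1 \notin clause_vars C :&: pdom rho by rewrite dC inE.
by rewrite !inE imset_f //= negbK => /eqP ->.
Qed.

(** If [a] is a model of [G], then [override rho a] is one of [H]: each clause is satisfied by
    [rho], or is untouched by it and comes from [G] or [E]. *)
Lemma vanishing_restrict G H rho c : respects rho E ->
  (forall F, F \in H -> satisfies rho F \/ F \in G /\ ~~ neighbour F (pdom rho)) ->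
  vanishing H c -> vanishing G (restrict rho c).
Proof.
move=> /forall_inP resp HG Wc a ma; rewrite eval_restrict; apply: Wc => C.
case/setUP=> [/bigcupP[F FH CF] | CE].
  case: (HG F FH) => [/forall_inP sat | [FG]].
    exact: satisfies_clause_override (sat C CF).
  rewrite negbK => /eqP dF; apply: untouched_override.
    apply/eqP; rewrite -subset0 -dF setSI //; exact: (bigcup_sup C).
  by apply: ma; apply/setUP; left; apply/bigcupP; exists F.
case/orP: (resp C CE) => [/eqP dC | sat]; last exact: satisfies_clause_override.
by apply: untouched_override => //; apply: ma; apply/setUP; right.
Qed.

Lemma vanishing_varmul G x c : vanishing G c -> vanishing G (varmul x c).
Proof. by move=> Wc a ma; rewrite eval_varmul Wc // mulr0. Qed.

Lemma vanishing_clause G F C : F \in G -> C \in F ->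
  vanishing G (mlcoefs (clause_poly K C)).
Proof.
move=> FG CF a ma; rewrite eval_clause_poly (negbTE (ma C _)) //.
by apply/setUP; left; apply/bigcupP; exists F.
Qed.

Lemma vanishing_axiom G C : C \in E -> vanishing G (mlcoefs (clause_poly K C)).
Proof.
move=> CE a ma; rewrite eval_clause_poly (negbTE (ma C _)) //.
by apply/setUP; right.
Qed.

Lemma satisfiable_model G : satisfiable (cnf_conj G E) -> exists a, models G a.
Proof.
case/existsP=> rho /forall_inP sat; exists (override rho set0) => C CG.
exact: satisfies_clause_override (sat C CG).
Qed.

(** * Normal forms modulo the support *)

Section Order.
Variable o : {set 'I_n} -> nat.
Hypothesis o_inj : injective o.
Hypothesis o_card : forall S T, (o T <= o S)%N -> (#|T| <= #|S|)%N.

Lemma monomial_restrict rho S :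
  [disjoint S & pdom rho] -> restrict rho (monomial K S) = monomial K S.
Proof.
move=> dS; apply: restrict_disjoint => T; rewrite ffunE.
by have [-> | _] := eqVneq T S; rewrite ?eqxx.
Qed.

(** Restricting [S - r], which vanishes modulo [G], gives [S - restrict rho r], which vanishes
    modulo [H] and so modulo [G]. Hence [r - restrict rho r] does too, and irreducibility keeps [r]
    off the domain. *)
Lemma normal_form_avoids G H S r rho : H \subset G ->
  normal_form o (vanishing G) S r -> [disjoint S & pdom rho] -> respects rho E ->
  (forall F, F \in G -> satisfies rho F \/ F \in H /\ ~~ neighbour F (pdom rho)) ->
  restrict rho r = r /\ forall T, r T != 0 -> [disjoint T & pdom rho].
Proof.
move=> sHG [Wr irr _] dS resp HG; have sW := vanishing_subspace G.
suff avoid T : r T != 0 -> [disjoint T & pdom rho].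
  by split=> //; apply: restrict_disjoint.
apply: (irreducible_restrict o_card irr).
rewrite (_ : r - _ = (monomial K S - restrict rho r) - (monomial K S - r)); last first.
  by rewrite opprB [RHS]addrC addrA subrK.
apply: (subspaceB sW _ Wr); apply: (vanishingS sHG).
by rewrite -{1}(monomial_restrict dS) -linearB; apply: vanishing_restrict Wr.
Qed.

(* Formulas outside the support are removed one at a time, each by restricting
   with the assignment of an escaping boundary set. *)
Lemma normal_form_descends G S r : (#|S| <= D)%N -> support S \subset G ->
  G \subset FF -> (#|G| <= s)%N ->
  normal_form o (vanishing G) S r -> normal_form o (vanishing (support S)) S r.
Proof.
move=> leSD; have [k] := ubnP #|G|; elim: k G => // k IHk G ltGk sSG sGF leGs nf.
have [-> // | neG] := eqVneq (support S) G.
have : ~~ (respectful_boundary E VV G \subset touched S).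
  apply: contra neG => bG; rewrite eqEsubset sSG support_max //.
  by rewrite /contained sGF leGs.
case/subsetPn=> V VG VNS.
have dSV : [disjoint S & V].
  by move: VNS; rewrite inE; case/respectful_boundaryP: VG => -> _; rewrite negbK.
have [F [rho [/setDP[FG FNS] dom sat resp nn]]] := escaping_boundary leSD sSG VG dSV.
have HG F' : F' \in G -> satisfies rho F' \/ F' \in G :\ F /\ ~~ neighbour F' (pdom rho).
  move=> F'G; have [-> | ne] := eqVneq F' F; [by left | right].
  by rewrite !inE ne F'G dom nn.
rewrite -dom in dSV.
have [rr _] := normal_form_avoids (subD1set G F) nf dSV resp HG.
case: nf => Wr irr leo; apply: (IHk (G :\ F)).
- by rewrite (cardsD1 F) FG in ltGk.
- apply/subsetP=> F' F'S; rewrite !inE (subsetP sSG) // andbT.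
  by apply: contraNneq FNS => <-.
- exact: subset_trans (subD1set _ _) sGF.
- exact: leq_trans (subset_leq_card (subD1set _ _)) leGs.
split=> //; last by apply: irreducibleS irr => f; apply: vanishingS (subD1set _ _).
rewrite -(monomial_restrict dSV) -{1}rr -linearB.
exact: vanishing_restrict Wr.
Qed.

(** A normal form modulo [G] descends to the support, where normal forms are unique; so it is
    [r]. *)
Lemma normal_form_ascends G S r : (#|S| <= D)%N -> support S \subset G ->
  G \subset FF -> (#|G| <= s)%N ->
  normal_form o (vanishing (support S)) S r -> normal_form o (vanishing G) S r.
Proof.
move=> leSD sSG sGF leGs nf.
have [t nft] := normal_form_exists o_inj S (vanishing_subspace G).
have nft' := normal_form_descends leSD sSG sGF leGs nft.
suff -> : r = t by [].
case: nf nft' => Wr irr_r _ [Wt irr_t _].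
apply: (irreducible_uniq (vanishing_subspace (support S)) irr_r irr_t).
rewrite (_ : r - t = (monomial K S - t) - (monomial K S - r)).
  exact: (subspaceB (vanishing_subspace _)).
by rewrite opprB [RHS]addrC addrA subrK.
Qed.

(** [Y] will be empty or the variable of a multiplication. The union [G] of both supports satisfies
    [contained (Y :|: S)]: a boundary set [V] untouched by [Y :|: S] would be untouched by [T] too,
    and its only neighbour in [G] would lie outside both supports. *)
Lemma normal_form_support Y S T r :
  (#|S| <= D)%N -> (#|Y :|: S| <= D)%N -> (#|Y :|: T| <= D)%N ->
  normal_form o (vanishing (support S)) S r -> r T != 0 ->
  support (Y :|: T) \subset support (Y :|: S).
Proof.
move=> leS leYS leYT nf nzT.
apply: subset_trans (subsetUr (support (Y :|: S)) _) _; apply: support_max.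
set G := _ :|: _; apply/and3P; split; first by rewrite subUset !support_sub.
  apply: leq_trans (leq_card_setU _ _) _.
  exact: add_halves (card_support leYS) (card_support leYT).
apply/subsetP=> V VG; apply/negPn/negP=> VNS.
have dV : [disjoint Y :|: S & V].
  by move: VNS; rewrite inE; case/respectful_boundaryP: VG => -> _; rewrite negbK.
have [F [rho [/setDP[FG FNS] dom sat resp nn]]] :=
  escaping_boundary leYS (subsetUl _ _) VG dV.
have dS : [disjoint S & pdom rho] by rewrite dom; apply: disjointWl dV; apply: subsetUr.
have [_ avoid] : restrict rho r = r /\ forall T, r T != 0 -> [disjoint T & pdom rho].
  (* No formula of [support S] meets [V], so restriction keeps the whole of [support S]. *)
  apply: (normal_form_avoids (subxx _) nf dS resp) => F' F'S; right; split=> //.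
  have F'YS : F' \in support (Y :|: S).
    by apply: subsetP F'S; apply: supportS; apply: subsetUr.
  rewrite dom nn //; first by rewrite inE F'YS.
  by apply: contraNneq FNS => <-.
have dYT : [disjoint Y :|: T & V].
  have := avoid T nzT; rewrite dom => dT.
  rewrite -setI_eq0 setIUl setU_eq0 !setI_eq0 dT andbT.
  by apply: disjointWl dV; apply: subsetUl.
have [F1 [rho1 [/setDP[F1G F1N] _ sat1 resp1 nn1]]] :=
  escaping_boundary leYT (subsetUr _ _) VG dYT.
have /respectful_boundaryP[_ [F2 [F2G /andP[nb2 _] nn2]]] := VG.
have eqF : F2 = F by apply/eqP/negPn/negP=> ne; case/negP: (nn _ F2G ne).
have eqF1 : F2 = F1 by apply/eqP/negPn/negP=> ne; case/negP: (nn1 _ F2G ne).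
by move: F1G; rewrite inE (negbTE F1N) orbF -eqF1 eqF (negbTE FNS).
Qed.

(** * The reduction operator and its kernel *)

Variable Red : {set 'I_n} -> coefs K n.
Hypothesis Red_nf : forall S, normal_form o (vanishing (support S)) S (Red S).

Definition reduce c : coefs K n := \sum_S c S *: Red S.

Fact reduce_is_linear : linear reduce.
Proof.
move=> k c f; rewrite /reduce scaler_sumr -big_split /=; apply: eq_bigr => S _.
by rewrite !ffunE scalerDl scalerA.
Qed.

HB.instance Definition _ :=
  GRing.isLinear.Build K (coefs K n) (coefs K n) *:%R reduce reduce_is_linear.

(** Each [Red S] involved is also a normal form modulo [G], so [reduce c] is irreducible there; it
    vanishes modulo [G] because [c] and [c - reduce c] do. Hence it is 0. *)
Lemma reduce_vanishing G c : G \subset FF -> (#|G| <= s)%N ->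
  (forall S, c S != 0 -> (#|S| <= D)%N /\ support S \subset G) ->
  vanishing G c -> reduce c = 0.
Proof.
move=> sGF leGs suppc Wc; have sW := vanishing_subspace G.
have nf S : c S != 0 -> normal_form o (vanishing G) S (Red S).
  by move=> /suppc[leS sS]; apply: normal_form_ascends.
have -> : reduce c = \sum_(S | c S != 0) c S *: Red S.
  rewrite [RHS]big_mkcond; apply: eq_bigr => S _.
  by have [-> | _] := eqVneq (c S) 0; rewrite ?scale0r.
apply: (@irreducible_eq0 _ _ o (vanishing G)); last first.
  by apply: irreducible_sum => S /nf[].
have eqc : c = \sum_(S | c S != 0) c S *: monomial K S.
  rewrite {1}[c]coefs_sum [RHS]big_mkcond; apply: eq_bigr => S _.
  by have [-> | _] := eqVneq (c S) 0; rewrite ?scale0r.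
rewrite (_ : \sum_(S | _) _ = c - \sum_(S | c S != 0) c S *: (monomial K S - Red S)).
  by apply: (subspaceB sW) => //; apply: subspace_sum => // S /nf[].
under [X in c - X]eq_bigr do rewrite scalerBr.
by rewrite sumrB -eqc opprB addrC subrK.
Qed.

Lemma reduce_id c : c - reduce c = \sum_S c S *: (monomial K S - Red S).
Proof.
by under [RHS]eq_bigr do rewrite scalerBr; rewrite sumrB -coefs_sum.
Qed.

Lemma residue_supp S T : (monomial K S - Red S) T != 0 -> T = S \/ Red S T != 0.
Proof.
rewrite !ffunE; have [-> | _] := eqVneq T S; first by left.
by rewrite sub0r oppr_eq0; right.
Qed.

Lemma residue_support Y S T :
  (#|S| <= D)%N -> (#|Y :|: S| <= D)%N -> (#|Y :|: T| <= D)%N ->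
  (monomial K S - Red S) T != 0 -> support (Y :|: T) \subset support (Y :|: S).
Proof.
move=> leS leYS leYT /residue_supp[-> // | nzT].
exact: normal_form_support (Red_nf S) nzT.
Qed.

Lemma residue_le S T : (monomial K S - Red S) T != 0 -> (o T <= o S)%N.
Proof. by case/residue_supp=> [-> // |]; case: (Red_nf S) => _ _; apply. Qed.

(** As [reduce c = 0], [c] is a combination of residues [S - Red S]. Multiplied by [x], each
    vanishes modulo [support (x |: S)], and its monomials have their supports inside that set; [o_x]
    keeps their degree at most [D]. *)
Lemma reduce_varmul x c :
  (forall S T, (o T <= o S)%N -> (#|x |: T| <= #|x |: S|)%N) ->
  (forall S, c S != 0 -> (#|S| <= D)%N) ->
  (forall S, varmul x c S != 0 -> (#|S| <= D)%N) ->
  reduce c = 0 -> reduce (varmul x c) = 0.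
Proof.
move=> o_x degc degxc c0.
(* If [S] had degree [D] and lacked [x], then [x |: S] would have coefficient [c S] in the product,
   as [c (x |: S)] is 0 for degree reasons. *)
have degx S : c S != 0 -> (#|x |: S| <= D)%N.
  move=> nzS; have [xS | xNS] := boolP (x \in S).
    by rewrite (setUidPr _) ?sub1set ?degc.
  rewrite leqNgt; apply/negP=> ltD; have := degxc (x |: S).
  rewrite leqNgt ltD ffunE setU11 setU1K //.
  have [-> | /degc] := eqVneq (c (x |: S)) 0; last by rewrite leqNgt ltD.
  by rewrite add0r => /(_ nzS).
rewrite -[c]subr0 -c0 reduce_id !linear_sum big1 //= => S _.
have [-> | nzS] := eqVneq (c S) 0; first by rewrite scale0r !linear0.
rewrite !linearZ /= (@reduce_vanishing (support (x |: S))) ?scaler0 ?support_sub //.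
- by have := card_support (degx S nzS); lia.
- move=> T nzT.
  suff [U [eqT nzU]] : exists U, T = x |: U /\ (monomial K S - Red S) U != 0.
    have leT : (#|T| <= D)%N.
      by rewrite eqT (leq_trans _ (degx S nzS)) // o_x // residue_le.
    split=> //; rewrite eqT; apply: residue_support nzU; rewrite -?eqT //.
      exact: degc.
    exact: degx.
  move: nzT; set g := monomial K S - Red S; rewrite ffunE.
  case: ifP => [xT|]; last by rewrite eqxx.
  have [-> | nzT _] := eqVneq (g T) 0; last by exists T; rewrite (setUidPr _) ?sub1set.
  by rewrite add0r => nzT; exists (T :\ x); rewrite setD1K.
apply: vanishing_varmul; apply: (@vanishingS (support S)); first exact/supportS/subsetUr.
by case: (Red_nf S).
Qed.

End Order.

(** * Independence of the order and closure under the rules *)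

(** All orders refining the degree are allowed, so that each multiplication can use its own. *)
Definition annihilated c := forall o Red, injective o ->
  (forall S T, (o T <= o S)%N -> (#|T| <= #|S|)%N) ->
  (forall S, normal_form o (vanishing (support S)) S (Red S)) -> reduce Red c = 0.

(** One order suffices: [c] is a combination of residues [S - Red S], which vanish modulo
    [support S] and whose monomials have their supports inside it. This holds regardless of the
    second order, so [reduce_vanishing] applies to it. *)
Lemma annihilated_order o Red c : injective o ->
  (forall S T, (o T <= o S)%N -> (#|T| <= #|S|)%N) ->
  (forall S, normal_form o (vanishing (support S)) S (Red S)) ->
  (forall S, c S != 0 -> (#|S| <= D)%N) -> reduce Red c = 0 -> annihilated c.
Proof.
move=> o_inj o_card Red_nf degc c0 o' Red' o'_inj o'_card Red'_nf.
rewrite -[c]subr0 -c0 reduce_id linear_sum big1 //= => S _.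
have [-> | nzS] := eqVneq (c S) 0; first by rewrite scale0r linear0.
rewrite linearZ /= (@reduce_vanishing o' _ _ _ _ (support S)) ?scaler0 ?support_sub //.
- by have := card_support (degc S nzS); lia.
- move=> T nzT.
  have leT : (#|T| <= D)%N.
    by apply: leq_trans (degc S nzS); apply: o_card; apply: residue_le nzT.
  split=> //; rewrite -[T]set0U -[S in _ \subset support S]set0U.
  by apply: (residue_support o_card Red_nf) nzT; rewrite ?set0U // degc.
by case: (Red_nf S).
Qed.

(* Degree first, then the penalty b, then an arbitrary enumeration. *)
Definition penalty_order (b : pred {set 'I_n}) S : nat :=
  ((2 * #|S| + b S) * #|{: {set 'I_n}}| + enum_rank S)%N.

Lemma penalty_order_inj b : injective (penalty_order b).
Proof.
move=> S T eqST; apply/enum_rank_inj/ord_inj.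
have := congr1 (modn^~ #|{: {set 'I_n}}|) eqST.
by rewrite /penalty_order !modnMDl !modn_small.
Qed.

Lemma penalty_order_le b S T : (penalty_order b T <= penalty_order b S)%N ->
  (2 * #|T| + b T <= 2 * #|S| + b S)%N.
Proof.
move=> leTS; have := leq_div2r #|{: {set 'I_n}}| leTS.
have pos : (0 < #|{: {set 'I_n}}|)%N by apply/card_gt0P; exists set0.
by rewrite /penalty_order !divnMDl // !divn_small // !addn0.
Qed.

Lemma penalty_order_card b S T :
  (penalty_order b T <= penalty_order b S)%N -> (#|T| <= #|S|)%N.
Proof. by move/penalty_order_le; case: (b T); case: (b S) => /=; lia. Qed.

Lemma penalty_reduction b : exists Red : {set 'I_n} -> coefs K n,
  forall S, normal_form (penalty_order b) (vanishing (support S)) S (Red S).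
Proof.
have /fin_all_exists[Red Red_nf] S :
    exists r, normal_form (penalty_order b) (vanishing (support S)) S r.
  by apply: normal_form_exists (vanishing_subspace _); apply: penalty_order_inj.
by exists Red.
Qed.

(* Even if c has degree D, multiplication by x must not create monomials of degree
   D + 1 from the normal forms; penalizing the monomials without x ensures it. *)
Lemma annihilated_varmul x c :
  (forall S, c S != 0 -> (#|S| <= D)%N) ->
  (forall S, varmul x c S != 0 -> (#|S| <= D)%N) ->
  annihilated c -> annihilated (varmul x c).
Proof.
move=> degc degxc annc.
pose b S := x \notin S.
have [Red Red_nf] := penalty_reduction b.
have o_inj := @penalty_order_inj b; have o_card := @penalty_order_card b.
apply: (annihilated_order o_inj o_card Red_nf) => //.
apply: (reduce_varmul o_inj o_card Red_nf) => //; last exact: annc Red_nf.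
(* [#|x |: S|] equals [#|S| + b S], which is monotone in [2 * #|S| + b S]. *)
move=> S T /penalty_order_le; rewrite !cardsU1 /b.
by case: (x \in T); case: (x \in S) => /=; lia.
Qed.

Lemma annihilated_clause C : (0 < s)%N -> C \in cnf_conj FF E ->
  (forall S, mlcoefs (clause_poly K C) S != 0 -> (#|S| <= D)%N) ->
  annihilated (mlcoefs (clause_poly K C)).
Proof.
move=> s_gt0 CFE degC o Red o_inj o_card Red_nf.
have [-> | /degC leCD] := clause_poly_top K C; first exact: linear0.
have lesup := card_support leCD.
have sup S : mlcoefs (clause_poly K C) S != 0 ->
    support S \subset support (clause_vars C).
  by move/clause_poly_supp/supportS.
case/setUP: CFE => [/bigcupP[F FFF CF] | CE].
  apply: (@reduce_vanishing o o_inj o_card Red Red_nf (F |: support (clause_vars C))).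
  - by rewrite subUset sub1set FFF support_sub.
  (* The support takes at most half of [s], rounded down; as [s] is positive, one more formula
     fits. *)
  - by rewrite cardsU1; lia.
  - move=> S nzS; split; first exact: degC.
    exact: subset_trans (sup S nzS) (subsetUr _ _).
  - by apply: (@vanishing_clause _ F) => //; apply: setU11.
apply: (@reduce_vanishing o o_inj o_card Red Red_nf (support (clause_vars C))).
- exact: support_sub.
- by lia.
- by move=> S nzS; split; [apply: degC | apply: sup].
- exact: vanishing_axiom.
Qed.

Lemma annihilated_lin k l c f :
  annihilated c -> annihilated f -> annihilated (k *: c + l *: f).
Proof.
move=> annc annf o Red o_inj o_card Red_nf; rewrite linearD !linearZ /=.
by rewrite (annc o) // (annf o) // !scaler0 addr0.
Qed.

(** Otherwise 1 would have normal form 0 and so vanish on the models of [support set0], of which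
    there is one. *)
Lemma monomial0_not_annihilated :
  (forall G, G \subset FF -> (#|G| <= s)%N -> satisfiable (cnf_conj G E)) ->
  ~ annihilated (monomial K set0).
Proof.
move=> sat ann.
have [Red Red_nf] := penalty_reduction xpred0.
have := ann _ _ (@penalty_order_inj xpred0) (@penalty_order_card xpred0) Red_nf.
rewrite /reduce (bigD1 set0) //= big1 => [|S ne0]; last first.
  by rewrite ffunE (negbTE ne0) scale0r.
rewrite ffunE eqxx scale1r addr0 => R0; have [] := Red_nf set0.
rewrite R0 subr0 => W0 _ _.
have le0 : (#|@set0 'I_n| <= D)%N by rewrite cards0.
have [|a ma] := @satisfiable_model (support set0).
  by apply: sat (support_sub _) _; have := card_support le0; lia.
by have /eqP := W0 a ma; rewrite eval_monomial sub0set oner_eq0.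
Qed.

End Supports.

(** * The degree bound *)

Lemma last1_mem (K : fieldType) (n : nat) (pi : seq {mpoly K[n]}) :
  last 0 pi = 1 -> 1 \in pi.
Proof.
case: pi => [/esym/eqP | P pi /= <-]; first by rewrite oner_eq0.
exact: mem_last.
Qed.

(** In degree 0 every line is constant, and the constant is 0: a clause polynomial is 0 where its
    clause holds, and a multiple of [x] has no constant term. *)
Lemma pc_degree_gt0 (K : fieldType) (n : nat) (Phi : cnf n) (pi : seq {mpoly K[n]}) :
  (forall C, C \in Phi -> exists a, ~~ falsifies a C) ->
  pc_refutation Phi pi -> (0 < pc_degree pi)%N.
Proof.
move=> sat [steps pi1]; rewrite lt0n; apply/eqP=> deg0.
have coef0 P S : P \in pi -> S != set0 -> mlcoefs P S = 0.
  move=> Ppi nz; apply/eqP/negPn/negP=> /(mlcoefs_degree Ppi).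
  by rewrite deg0 leqn0 cards_eq0 (negbTE nz).
have evc P a : P \in pi -> eval a (mlcoefs P) = mlcoefs P set0.
  move=> Ppi; rewrite /eval (bigD1 set0) ?sub0set //= big1 ?addr0 //.
  by move=> S /andP[_ nz]; apply: coef0.
have zero : forall P, P \in pi -> mlcoefs P set0 = 0.
  apply: (pc_ind steps) => [C CPhi Cpi | k l P Q P0 Q0 | x P Ppi xPpi mP P0].
  - have [a fa] := sat C CPhi.
    by rewrite -(evc _ a) // eval_clause_poly (negbTE fa).
  - by move: P0 Q0; rewrite !ffunE mcoeffD !mcoeffZ => -> ->; rewrite !mulr0 addr0.
  - by rewrite mlcoefs_varmul // ffunE inE.
by have /zero/eqP := last1_mem pi1; rewrite mlcoefs1 ffunE eqxx oner_eq0.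
Qed.

Theorem theorem3p8 (K : fieldType) (R : realFieldType) (n : nat)
    (E : cnf n) (FF : {set cnf n}) (VV : {set {set 'I_n}})
    (s d : nat) (delta xi : R)
    (s_gt0 : (0 < s)%N)
    (VV_respects : forall V : {set 'I_n}, V \in VV -> set_respects V E)
    (expander : respectful_boundary_expander FF VV s delta xi E)
    (overlap_d : overlap VV = d)
    (small_sat : forall FF' : {set cnf n},
        FF' \subset FF -> (#|FF'| <= s)%N -> satisfiable (cnf_conj FF' E))
    (pi : seq {mpoly K[n]})
    (pi_refutes : pc_refutation (cnf_conj FF E) pi) :
  (delta * s%:R - 2 * xi) / (2 * d%:R) < (pc_degree pi)%:R.
Proof.
have deg_gt0 : (0 < pc_degree pi)%N.
  apply: pc_degree_gt0 pi_refutes => C /setUP[/bigcupP[F FFF CF] | CE].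
    have [|a ma] := @satisfiable_model _ E [set F].
      by apply: small_sat; rewrite ?sub1set ?cards1.
    by exists a; apply: ma; apply/setUP; left; rewrite big_set1.
  have [|a ma] := @satisfiable_model _ E set0.
    by apply: small_sat; rewrite ?sub0set ?cards0.
  by exists a; apply: ma; apply/setUP; right.
set D := pc_degree pi in deg_gt0 *; rewrite ltNge; apply/negP=> leD.
have D_gt0 : 0 < D%:R :> R by rewrite ltr0n.
(* Division by 0 yields 0, so [d = 0] would give [D <= 0]. *)
have d_gt0 : 0 < d%:R :> R.
  rewrite ltr0n lt0n; apply/eqP=> d0; move: leD; rewrite d0 mulr0 invr0 mulr0.
  by rewrite leNgt D_gt0.
rewrite ler_pdivlMr in leD; last by rewrite mulr_gt0.
(* Expansion applied to the empty set, whose boundary is empty. *)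
have xi_ge0 : 0 <= xi.
  have := expander set0 (sub0set _); rewrite cards0 => /(_ isT).
  rewrite mulr0 sub0r (_ : respectful_boundary _ _ _ = set0) ?cards0 ?oppr_le0 //.
  apply/setP=> V; rewrite [RHS]inE; apply/respectful_boundaryP=> -[_ [F []]].
  by rewrite inE.
have s0 : 0 < s%:R :> R by rewrite ltr0n.
have delta_gt0 : 0 < delta.
  rewrite -(pmulr_lgt0 _ s0); have := mulr_gt0 D_gt0 d_gt0.
  by move: leD; lra.
(* [delta #|G| - xi <= d D] and [2 d D <= delta s - 2 xi] give [2 delta #|G| <= delta s]. *)
have half (S : {set 'I_n}) G :
    (#|S| <= D)%N -> contained E FF VV s S G -> (2 * #|G| <= s)%N.
  move=> leS /and3P[sG leG bG]; have := expander G sG leG.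
  have : (#|respectful_boundary E VV G| <= d * D)%N.
    apply: leq_trans (subset_leq_card bG) _; apply: leq_trans (card_touched VV S) _.
    by rewrite overlap_d leq_mul2l leS orbT.
  rewrite -(ler_nat R) natrM => leb lb.
  rewrite -(ler_nat R) natrM -(ler_pM2l delta_gt0).
  by move: leD leb lb; lra.
case: pi_refutes => steps pi1.
have ann : forall P, P \in pi -> annihilated E FF VV s (mlcoefs P).
  apply: (pc_ind steps) => [C CPhi Cpi | k l P Q annP annQ | x P Ppi xPpi mP annP].
  - apply: (annihilated_clause half s_gt0 CPhi) => S; exact: mlcoefs_degree.
  - by rewrite linearD !linearZ; apply: annihilated_lin.
  - rewrite mlcoefs_varmul //; apply: (annihilated_varmul half) annP => S;
      rewrite -?mlcoefs_varmul //; exact: mlcoefs_degree.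
have /ann := last1_mem pi1; rewrite mlcoefs1.
exact: (monomial0_not_annihilated half small_sat).
Qed.
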